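(* Let $n \geq 3$ be an integer, let $R_n$ denote the square rook's graph and $R_n^c$ its complement. Then the critical groups and Smith groups of these graphs are given by the following isomorphisms: \begin{align*} K(R_{n}) &\cong \left(\mathbb{Z}/2n\mathbb{Z}\right)^{(n-2)^2 + 1} \oplus \left(\mathbb{Z}/2n^{2}\mathbb{Z}\right)^{2(n-2)},\\ S(R_{n}) &\cong \left(\mathbb{Z}/2\mathbb{Z}\right)^{(n-2)^{2}} \oplus \left(\mathbb{Z}/2(n-2)\mathbb{Z}\right)^{2n-3} \oplus \mathbb{Z}/2(n-1)(n-2)\mathbb{Z},\\ K(R_{n}^{c}) &\cong \left(\mathbb{Z}/n(n-2)\mathbb{Z}\right)^{(n-2)^{2}-1} \oplus \left(\mathbb{Z}/n(n-1)(n-2)\mathbb{Z}\right)^{2} \oplus \left(\mathbb{Z}/n^{2}(n-1)(n-2)\mathbb{Z}\right)^{2(n-2)},\\ S(R_{n}^{c}) &\cong \left(\mathbb{Z}/(n-1)\mathbb{Z}\right)^{2(n-1)} \oplus \mathbb{Z}/(n-1)^{2}\mathbb{Z}. \end{align*}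
   Context: The square rook's graph $R_n$ has as vertex set the $n^2$ squares of an $n\times n$ grid, two distinct squares being adjacent when they lie in the same row or the same column (equivalently, $R_n$ is the Cartesian product $K_n \square K_n$, or the line graph of $K_{n,n}$). Its complement $R_n^c$ has the same vertex set, with two distinct squares adjacent iff they lie in different rows and different columns. For a simple graph $\Gamma$ with vertices ordered arbitrarily, the adjacency matrix $A$ has $(i,j)$ entry $1$ if vertices $i,j$ are adjacent and $0$ otherwise; the Laplacian matrix is $L = D - A$ where $D$ is the diagonal matrix of vertex degrees. Viewing an integer square matrix $M$ indexed by the vertices as a homomorphism $\mathbb{Z}^{V} \to \mathbb{Z}^{V}$, the Smith group $S(\Gamma)$ is the cokernel $\mathbb{Z}^V/\operatorname{im}(A)$, and the critical group $K(\Gamma)$ is the torsion subgroup of the cokernel $\mathbb{Z}^V/\operatorname{im}(L)$. *)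

(* Defs.v *)
From HB Require Import structures.
From mathcomp Require Import all_boot all_order all_algebra.
From mathcomp Require Import boolp.

Set Implicit Arguments.
Unset Strict Implicit.
Unset Printing Implicit Defensive.

Import GRing.Theory.
Local Open Scope ring_scope.

Record sgraph := SGraph {
  vertex :> finType;
  adj : rel vertex;
  adj_sym : symmetric adj;
  adj_irr : irreflexive adj
}.

Section Complement.
Variable G : sgraph.

Definition compl_adj : rel G := [rel u v | (u != v) && ~~ adj u v].

Fact compl_adj_sym : symmetric compl_adj.
Proof. by move=> u v; rewrite /compl_adj /= eq_sym adj_sym. Qed.

Fact compl_adj_irr : irreflexive compl_adj.
Proof. by move=> u; rewrite /compl_adj /= eqxx. Qed.

Definition complement := SGraph compl_adj_sym compl_adj_irr.

End Complement.

Section Rook.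
Variable n : nat.

Definition rook_adj : rel ('I_n * 'I_n)%type :=
  [rel u v | (u != v) && ((u.1 == v.1) || (u.2 == v.2))].

Fact rook_adj_sym : symmetric rook_adj.
Proof.
by move=> u v; rewrite /rook_adj /= eq_sym (eq_sym u.1) (eq_sym u.2).
Qed.

Fact rook_adj_irr : irreflexive rook_adj.
Proof. by move=> u; rewrite /rook_adj /= eqxx. Qed.

Definition rook := SGraph rook_adj_sym rook_adj_irr.

End Rook.

Section GraphMatrices.
Variable G : sgraph.

(* The vertices are ordered by [enum G]. *)
Definition adjacency : 'M[int]_#|G| :=
  \matrix_(i, j) (adj (enum_val i) (enum_val j))%:R.

Definition degree (u : G) : nat := #|[set v | adj u v]|.

Definition laplacian : 'M[int]_#|G| :=
  diag_mx (\row_i (degree (enum_val i))%:R) - adjacency.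

End GraphMatrices.

Section Cokernel.
Variables (m : nat) (M : 'M[int]_m).

Definition im_mx : {pred 'cV[int]_m} := [pred y | `[< exists x, y = M *m x >]].

Fact im_mx_zmod_closed : zmod_closed im_mx.
Proof.
split; first by apply/asboolP; exists 0; rewrite mulmx0.
move=> x y /asboolP[x' ->] /asboolP[y' ->].
by apply/asboolP; exists (x' - y'); rewrite mulmxBr.
Qed.

HB.instance Definition _ :=
  GRing.isZmodClosed.Build 'cV[int]_m im_mx im_mx_zmod_closed.

Definition cokernel : zmodType := Quotient.quot im_mx.

End Cokernel.

Section Torsion.
Variable A : zmodType.

Definition torsion_pred : {pred A} :=
  [pred x | `[< exists2 k : nat, (0 < k)%N & x *+ k = 0 >]].

Fact torsion_zmod_closed : zmod_closed torsion_pred.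
Proof.
split; first by apply/asboolP; exists 1%N.
move=> x y /asboolP[k k0 xk] /asboolP[l l0 yl].
apply/asboolP; exists (k * l)%N; first by rewrite muln_gt0 k0.
by rewrite mulrnBl mulrnA xk mul0rn mulnC mulrnA yl mul0rn subr0.
Qed.

HB.instance Definition _ :=
  GRing.isZmodClosed.Build A torsion_pred torsion_zmod_closed.

Record torsion := Torsion { torsion_val : A; _ : torsion_val \in torsion_pred }.

HB.instance Definition _ := [isSub for torsion_val].
HB.instance Definition _ := [Choice of torsion by <:].
HB.instance Definition _ := [SubChoice_isSubZmodule of torsion by <:].

End Torsion.

Definition smith_group (G : sgraph) : zmodType := cokernel (adjacency G).

Definition critical_group (G : sgraph) : zmodType :=
  torsion (cokernel (laplacian G)).

Definition zmod_iso (A B : zmodType) : Prop :=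
  exists f : {additive A -> B}, bijective f.

(* Main.v *)
(** Identify Z^V with the n x n integer matrices.  Each of the four matrices then
acts as X |-> a X + b (J X + X J) + c J X J, where J is the all-ones matrix.  Since
J is conjugate over Z to [[n, 0], [1, 0]] (+) 0_(n-2), the change of variables
X = P Z P^T splits this operator into (n-2)^2 copies of the scalar a, 2 (n-2)
copies of [[a + b n, 0], [b, a]], and one operator on Z^4.  When b = 1 or -1, the
2 x 2 matrix has cokernel Z/a(a + b n), read off by the functional
x |-> (a + b n) x_1 - b x_0, and the cokernel of the 4 x 4 operator is computed
directly in each of the four cases.  For the critical group of the complement,
the stated invariants are reached through Z/n(n-2) (+) Z/(n-1) = Z/n(n-1)(n-2). *)

Require Import Defs.
From HB Require Import structures.
From mathcomp Require Import all_boot all_order all_algebra.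
From mathcomp Require Import boolp zify ring.

Set Implicit Arguments.
Unset Strict Implicit.
Unset Printing Implicit Defensive.

Import GRing.Theory Num.Theory.
Local Open Scope ring_scope.
Local Open Scope quotient_scope.

(** * Isomorphisms and cokernels *)

(* B is the cokernel of f. *)
Definition presents (X : Type) (Y B : zmodType) (f : X -> Y) : Prop :=
  exists p : Y -> B,
    [/\ {morph p : x y / x - y},
        forall b, exists y, p y = b
      & forall y, p y = 0 <-> exists x, y = f x].
Arguments presents {X Y} B f.

Lemma zmod_isoI (A B : zmodType) (f : A -> B) :
  {morph f : x y / x - y} -> bijective f -> zmod_iso A B.
Proof.
move=> fB fbij.
pose F := HB.pack_for {additive A -> B} f (GRing.isZmodMorphism.Build A B f fB).
by exists F.
Qed.

Lemma morphB0 (A B : zmodType) (f : A -> B) : {morph f : x y / x - y} -> f 0 = 0.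
Proof. by move=> fB; rewrite -(subrr 0) fB subrr. Qed.

Lemma zmod_iso_inj_surj (A B : zmodType) (f : A -> B) :
  {morph f : x y / x - y} -> (forall x, f x = 0 -> x = 0) ->
  (forall b, exists x, f x = b) -> zmod_iso A B.
Proof.
move=> fB f0 fsurj; apply: (zmod_isoI fB).
have fex b : exists x, f x == b by have [x <-] := fsurj b; exists x.
exists (fun b => xchoose (fex b)) => [x|b]; last exact: (eqP (xchooseP (fex b))).
by apply/subr0_eq/f0; rewrite fB (eqP (xchooseP (fex (f x)))) subrr.
Qed.

(** First isomorphism theorem. A chosen representative of a class is determined only modulo the
    image of [M], where [p] vanishes, so [p \o repr] does not depend on the choice. *)
Lemma presents_cokernel (m : nat) (M : 'M[int]_m) (B : zmodType) :
  presents B (fun x : 'cV[int]_m => M *m x) -> zmod_iso (cokernel M) B.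
Proof.
case=> p [pB psurj pker].
have p_repr y : p (repr (\pi_(cokernel M) y)) = p y.
  apply/subr0_eq; rewrite -pB; apply/pker.
  have /asboolP[x xE] : repr (\pi_(cokernel M) y) - y \in im_mx M.
    by rewrite Quotient.idealrBE reprK.
  by exists x.
apply: (@zmod_iso_inj_surj _ _ (fun q : cokernel M => p (repr q))).
- by move=> x y; rewrite -[x]reprK -[y]reprK -raddfB !p_repr pB.
- move=> q /pker[x xE]; rewrite -[q]reprK xE.
  rewrite -(raddf0 \pi_(cokernel M)); apply/eqP.
  by rewrite -Quotient.idealrBE subr0; apply/asboolP; exists x.
- by move=> b; have [y <-] := psurj b; exists (\pi y); rewrite p_repr.
Qed.

Lemma zmod_iso_sym (A B : zmodType) : zmod_iso A B -> zmod_iso B A.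
Proof.
case=> f [g fK gK]; apply: (@zmod_isoI _ _ g); last by exists f.
by move=> x y; apply: (can_inj fK); rewrite raddfB !gK.
Qed.

Lemma zmod_iso_refl (A : zmodType) : zmod_iso A A.
Proof. by apply: (@zmod_isoI _ _ id) => //; exists id. Qed.

Lemma zmod_iso_trans (B A C : zmodType) :
  zmod_iso A B -> zmod_iso B C -> zmod_iso A C.
Proof.
move=> [f fbij] [g gbij]; apply: (@zmod_isoI _ _ (g \o f)).
  by move=> x y /=; rewrite !raddfB.
exact: bij_comp.
Qed.

Lemma zmod_iso_prod (A B C D : zmodType) :
  zmod_iso A B -> zmod_iso C D -> zmod_iso (A * C)%type (B * D)%type.
Proof.
move=> [f [f' fK f'K]] [g [g' gK g'K]].
apply: (@zmod_isoI _ _ (fun x : A * C => (f x.1, g x.2))).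
  by move=> [a c] [b d] /=; rewrite !raddfB.
by exists (fun x => (f' x.1, g' x.2)) => -[a b] /=; rewrite ?fK ?gK ?f'K ?g'K.
Qed.

Lemma zmod_iso_prod0 (A Z : zmodType) :
  (forall z : Z, z = 0) -> zmod_iso (A * Z)%type A.
Proof.
move=> Z0; apply: (@zmod_isoI _ _ fst); first by case=> [? ?] [].
by exists (fun a => (a, 0)) => [[a z]|a] //=; rewrite (Z0 z).
Qed.

Lemma zmod_iso_rowD (R : zmodType) (k l : nat) :
  zmod_iso ('rV[R]_k * 'rV[R]_l)%type 'rV[R]_(k + l).
Proof.
apply: (@zmod_isoI _ _ (fun x : 'rV_k * 'rV_l => row_mx x.1 x.2)).
  by move=> [? ?] [? ?] /=; rewrite opp_row_mx add_row_mx.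
exists (fun x => (lsubmx x, rsubmx x)) => [[x y]|x] /=.
  by rewrite row_mxKl row_mxKr.
by rewrite hsubmxK.
Qed.

Lemma zmod_iso_mxvec (R : zmodType) (k l : nat) :
  zmod_iso 'M[R]_(k, l) 'rV[R]_(k * l).
Proof.
apply: (@zmod_isoI _ _ mxvec); last by exists vec_mx; [exact: mxvecK|exact: vec_mxK].
by move=> x y; apply/rowP=> i; case/mxvec_indexP: i => i j; rewrite !(mxvecE, mxE).
Qed.

Lemma zmod_iso_rV1 (R : zmodType) : zmod_iso 'rV[R]_1 R.
Proof.
apply: (@zmod_isoI _ _ (fun x : 'rV_1 => x 0 0)); first by move=> x y; rewrite !mxE.
by exists (fun a => const_mx a) => [x|a]; rewrite ?mxE //; apply/rowP=> i; rewrite ord1 mxE.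
Qed.

Lemma zmod_iso_torsion (A B : zmodType) : zmod_iso A B -> zmod_iso (torsion A) (torsion B).
Proof.
case=> f [g fK gK].
have gB : {morph g : x y / x - y}.
  by move=> x y; apply: (can_inj fK); rewrite raddfB !gK.
have gMn x k : g (x *+ k) = g x *+ k.
  by apply: (can_inj fK); rewrite raddfMn !gK.
have fP (x : torsion A) : f (val x) \in @torsion_pred B.
  have /asboolP[k k0 kx] := valP x.
  by apply/asboolP; exists k; rewrite // -raddfMn kx raddf0.
have gP (y : torsion B) : g (val y) \in @torsion_pred A.
  have /asboolP[k k0 ky] := valP y.
  by apply/asboolP; exists k; rewrite // -gMn ky (morphB0 gB).
apply: (@zmod_isoI _ _ (fun x => Sub (f (val x)) (fP x) : torsion B)).
  by move=> x y; apply: val_inj; rewrite [LHS]SubK [RHS]raddfB !SubK !raddfB.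
exists (fun y => Sub (g (val y)) (gP y) : torsion A) => z; apply: val_inj.
  by rewrite !SubK fK.
by rewrite !SubK gK.
Qed.

(** Serves to discard the free summand of the cokernel of a Laplacian. The exponent [N] makes all of
    [B] torsion, while the component in Z of a torsion element is 0. *)
Lemma torsion_int_prod (B : zmodType) (N : nat) :
  (0 < N)%N -> (forall b : B, b *+ N = 0) -> zmod_iso (torsion (int * B)%type) B.
Proof.
move=> N0 BN.
have torP (b : B) : ((0, b) : (int * B)%type) \in @torsion_pred (int * B)%type.
  apply/asboolP; exists N => //.
  apply/eqP; rewrite -pair_eqE /= /pair_eq; rewrite !raddfMn /= BN mul0rn.
  by rewrite !eqxx.
apply: (@zmod_isoI _ _ (fun x : torsion (int * B)%type => (val x).2)).
  by move=> x y; rewrite raddfB.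
exists (fun b => Sub (0, b) (torP b) : torsion (int * B)%type) => [x|b].
  apply: val_inj; rewrite SubK.
  have /asboolP[k k0 kx] := valP x.
  have /eqP : ((val x).1 *+ k = 0) by rewrite -raddfMn kx.
  rewrite mulrn_eq0 gtn_eqF //= => /eqP x0.
  by move: x0; case: (val x) => u v /= ->.
by rewrite SubK.
Qed.

(** Invariance of the cokernel under a change of coordinates. The targets must be isomorphic through
    [h], but for equality of the images it is enough that [g] be onto, with section [g']. *)
Lemma presents_conj (X X' : Type) (Y Y' B : zmodType) (f : X -> Y) (f' : X' -> Y')
    (g : X' -> X) (g' : X -> X') (h : Y' -> Y) (h' : Y -> Y') :
  {morph h : x y / x - y} -> cancel h h' -> cancel h' h -> cancel g' g ->
  (forall x, h (f' x) = f (g x)) -> presents B f -> presents B f'.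
Proof.
move=> hB hK h'K g'K hf [p [pB psurj pker]]; exists (p \o h); split.
- by move=> x y /=; rewrite hB pB.
- by move=> b; have [y <-] := psurj b; exists (h' y); rewrite /= h'K.
- move=> y /=; rewrite pker; split=> -[x xE].
    by exists (g' x); apply: (can_inj hK); rewrite hf g'K.
  by exists (g x); rewrite xE hf.
Qed.

Lemma presents_prod (X X' : Type) (Y Y' B B' : zmodType) (f : X -> Y) (f' : X' -> Y') :
  presents B f -> presents B' f' ->
  presents (B * B')%type (fun x : X * X' => (f x.1, f' x.2) : (Y * Y')%type).
Proof.
move=> [p [pB psurj pker]] [q [qB qsurj qker]].
exists (fun y : Y * Y' => (p y.1, q y.2)); split.
- by move=> [? ?] [? ?] /=; rewrite pB qB.
- move=> [b c]; have [y <-] := psurj b; have [z <-] := qsurj c.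
  by exists (y, z).
- move=> [y z] /=; split=> [[/pker[x ->] /qker[x' ->]]|[[x x'] /= [-> ->]]].
    by exists (x, x').
  by congr (_, _); [apply/pker; exists x | apply/qker; exists x'].
Qed.

Lemma presents_iso (X : Type) (Y B C : zmodType) (f : X -> Y) :
  presents B f -> zmod_iso B C -> presents C f.
Proof.
move=> [p [pB psurj pker]] [g [g' gK g'K]]; exists (g \o p); split.
- by move=> x y /=; rewrite pB raddfB.
- by move=> c; have [y yE] := psurj (g' c); exists y; rewrite /= yE g'K.
- move=> y /=; rewrite -pker; split=> [|->]; last exact: raddf0.
  by rewrite -{1}(raddf0 g) => /(can_inj gK).
Qed.

(** * Residues modulo d and the Chinese remainder theorem *)

Lemma Zp_intr_eq0 (d : nat) (z : int) :
  (1 < d)%N -> (z%:~R = 0 :> 'Z_d) <-> exists q, z = d%:Z * q.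
Proof.
(* ['Z_d] is Z/d only for d > 1; for d = 0 or 1 it is Z/2 by convention. *)
move=> d1; have dR : (d%:Z)%:~R = 0 :> 'Z_d by rewrite -pmulrn pchar_Zp.
split=> [z0|[q ->]]; last by rewrite intrM dR mul0r.
exists (divz z d); rewrite mulrC [LHS](divz_eq z d).
suff -> : (z %% d)%Z = 0 by rewrite addr0.
have r0 : (modz z d)%:~R = 0 :> 'Z_d.
  by move: z0; rewrite {1}(divz_eq z d) intrD intrM dR mulr0 add0r.
have := modz_ge0 z (_ : d%:Z != 0); have := ltz_pmod z (_ : 0 < d%:Z).
case: (modz z d) r0 => [r r0 ltr _|r _ _ /(_ _)]; last by lia.
congr Posz; move/(congr1 val): r0; rewrite -pmulrn /= val_Zp_nat //= modn_small //.
by apply: ltr; lia.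
Qed.

Lemma Zp_intr_surj (d : nat) (a : 'Z_d) : exists z : int, z%:~R = a.
Proof. by exists (nat_of_ord a)%:Z; rewrite -pmulrn natr_Zp. Qed.

Lemma map_intr_eq0 (d k l : nat) (X : 'M[int]_(k, l)) : (1 < d)%N ->
  map_mx (intr : int -> 'Z_d) X = 0 <-> exists Q, X = d%:Z *: Q.
Proof.
move=> d1; split=> [/matrixP X0|[Q ->]].
  have Xq i j : exists q, X i j == d%:Z * q.
    have : (X i j)%:~R = 0 :> 'Z_d by have := X0 i j; rewrite !mxE.
    by case/(Zp_intr_eq0 _ d1) => q ->; exists q.
  exists (\matrix_(i, j) xchoose (Xq i j)); apply/matrixP=> i j.
  by rewrite !mxE; apply/eqP/(xchooseP (Xq i j)).
apply/matrixP=> i j; rewrite !mxE; apply/(Zp_intr_eq0 _ d1).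
by exists (Q i j).
Qed.

Lemma map_intr_surj (d k l : nat) (B : 'M['Z_d]_(k, l)) :
  exists X, map_mx (intr : int -> 'Z_d) X = B.
Proof.
exists (map_mx (fun x : 'Z_d => (nat_of_ord x)%:Z) B).
by apply/matrixP=> i j; rewrite !mxE -pmulrn natr_Zp.
Qed.

Lemma map_intrB (d k l : nat) :
  {morph map_mx (intr : int -> 'Z_d) : X Y / X - Y : 'M_(k, l)}.
Proof. by move=> X Y; apply/matrixP=> i j; rewrite !mxE intrB. Qed.

(** Lift along [p], then apply [q]: both kernels are the image of [f], so the result is well defined
    and injective. *)
Lemma presents_unique (X : Type) (Y B C : zmodType) (f : X -> Y) :
  presents B f -> presents C f -> zmod_iso B C.
Proof.
move=> [p [pB psurj pker]] [q [qB qsurj qker]].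
have pex b : exists y, p y == b by have [y <-] := psurj b; exists y.
have lift b : p (xchoose (pex b)) = b by apply/eqP/(xchooseP (pex b)).
have pq y z : p y = p z -> q y = q z.
  by move=> yz; apply/subr0_eq; rewrite -qB; apply/qker/pker; rewrite pB yz subrr.
apply: (@zmod_iso_inj_surj _ _ (fun b => q (xchoose (pex b)))).
- by move=> x y; rewrite -qB; apply: pq; rewrite pB !lift.
- by move=> b /qker/pker; rewrite lift.
- by move=> c; have [y <-] := qsurj c; exists (p y); apply: pq; rewrite lift.
Qed.

Lemma presents_mulz (d : nat) :
  (1 < d)%N -> presents 'Z_d (fun x : int => d%:Z * x).
Proof.
move=> d1; exists intr; split; first by move=> x y; rewrite intrB.
  exact: Zp_intr_surj.
by move=> y; apply: Zp_intr_eq0.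
Qed.

(** Chinese remainder theorem from a Bezout relation: both groups are cokernels of multiplication by
    de on Z. *)
Lemma zmod_iso_Zp_prod (d e : nat) (u v : int) :
  (1 < d)%N -> (1 < e)%N -> u * d%:Z + v * e%:Z = 1 ->
  zmod_iso ('Z_d * 'Z_e)%type 'Z_(d * e).
Proof.
move=> d1 e1 uv; have de1 : (1 < d * e)%N by lia.
apply: presents_unique (presents_mulz de1).
exists (fun z : int => (z%:~R, z%:~R)); split.
- by move=> x y; rewrite !intrB.
- move=> [a b]; have [x <-] := Zp_intr_surj a; have [y <-] := Zp_intr_surj b.
  (* By the Bezout relation, ve is 1 modulo d and 0 modulo e, and ud the reverse. *)
  exists (x * (v * e%:Z) + y * (u * d%:Z)); congr (_, _); apply/subr0_eq; rewrite -intrB.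
    apply/(Zp_intr_eq0 _ d1); exists ((y - x) * u).
    have -> : v * e%:Z = 1 - u * d%:Z by rewrite -uv; ring.
    ring.
  apply/(Zp_intr_eq0 _ e1); exists ((x - y) * v).
  have -> : u * d%:Z = 1 - v * e%:Z by rewrite -uv; ring.
  ring.
- move=> y; split=> [[/(Zp_intr_eq0 _ d1)[q yq] /(Zp_intr_eq0 _ e1)[r yr]]|[x ->]].
    exists (r * u + q * v); rewrite -[y]mulr1 -uv mulrDr.
    by rewrite {1}yr yq PoszM; ring.
  congr (_, _).
    by apply/(Zp_intr_eq0 _ d1); exists (e%:Z * x); rewrite PoszM mulrA.
  by apply/(Zp_intr_eq0 _ e1); exists (d%:Z * x); rewrite PoszM; ring.
Qed.

(** * Cokernels of the scalar, 2 x 2 and 4 x 4 blocks *)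

Lemma presents_scale (k l d : nat) (a : int) : (1 < d)%N -> `|a|%N = d ->
  presents 'M['Z_d]_(k, l) (fun X : 'M[int]_(k, l) => a *: X).
Proof.
move=> d1 ad; exists (map_mx intr); split; [exact: map_intrB|exact: map_intr_surj|].
have [s [aE sE]] : exists s, a = s * d%:Z /\ s * s = 1.
  by have [->|->] : a = d%:Z \/ a = - d%:Z by [lia]; [exists 1|exists (-1)]; split; ring.
move=> Y; rewrite map_intr_eq0 //; split=> -[X ->].
  by exists (s *: X); rewrite scalerA aE mulrAC sE mul1r.
by exists (s *: X); rewrite scalerA aE mulrC.
Qed.

(** The scalar 1 needs its own case, since ['Z_1] is not trivial; ['rV[int]_0] stands for the zero
    group. It occurs for the Smith group of the complement. *)
Lemma presents_scale_unit (k l : nat) :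
  presents 'rV[int]_0 (fun X : 'M[int]_(k, l) => 1 *: X).
Proof.
exists (fun=> 0); split=> [x y|b|y].
- by rewrite subrr.
- by exists 0; apply/rowP; case.
- by split=> // _; exists y; rewrite scale1r.
Qed.

(** The [m] copies of the block [[a + b n, 0], [b, a]] side by side: column j of the two rows is the
    vector on which copy j acts. *)
Definition row_block (m : nat) (a b n : int) (x : 'rV[int]_m * 'rV[int]_m) :
  'rV[int]_m * 'rV[int]_m := ((a + b * n) *: x.1, b *: x.1 + a *: x.2).

(** Each 2 x 2 block has determinant a (a + b n) and the unit entry b, so its cokernel is cyclic of
    order the absolute value of the determinant. *)
Lemma presents_row_block (m d : nat) (a b n : int) :
  (1 < d)%N -> b * b = 1 -> `|(a * (a + b * n))%R|%N = d ->
  presents 'rV['Z_d]_m (@row_block m a b n).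
Proof.
move=> d1 bb adE.
have [s [aE sE]] : exists s, d%:Z = s * (a * (a + b * n)) /\ s * s = 1.
  set w := a * _ in adE *.
  by have [->|->] : w = d%:Z \/ w = - d%:Z by [lia]; [exists 1|exists (-1)]; split; ring.
exists (fun x : 'rV_m * 'rV_m => map_mx intr ((a + b * n) *: x.2 - b *: x.1)); split.
- move=> [x0 x1] [y0 y1] /=; rewrite -map_intrB; congr map_mx.
  by apply/rowP=> i; rewrite !mxE; ring.
- move=> r; have [X <-] := map_intr_surj r; exists (- b *: X, 0).
  by rewrite /= scaler0 sub0r scalerA mulrN bb scaleN1r opprK.
- move=> [x0 x1] /=; rewrite map_intr_eq0 //; split=> [[r rE]|[[y0 y1] [-> ->]]].
    (* The second component forces b y0 = x1 - a y1, solved with 1/b = b; then y1 = s r makes the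
       first component agree. *)
    exists (b *: x1 - (b * s * a) *: r, s *: r); congr (_, _); apply/rowP=> i /=.
      have := congr1 (fun v : 'rV_m => - b * v 0 i) rE; rewrite !mxE => h.
      transitivity (b * b * x0 0 i); first by rewrite bb mul1r.
      transitivity (b * (a + b * n) * x1 0 i
                    + - b * ((a + b * n) * x1 0 i - b * x0 0 i)); first by ring.
      by rewrite h aE; ring.
    rewrite !mxE; transitivity (b * b * (x1 0 i - s * a * r 0 i) + s * a * r 0 i).
      by rewrite bb; ring.
    by ring.
  exists (s *: y1); apply/rowP=> i; rewrite !mxE aE.
  transitivity (s * s * (a * (a + b * n) * y1 0 i)); last by ring.
  by rewrite sE; ring.
Qed.

(** With K = [[n, 0], [1, 0]], this is Z |-> a Z + b (K Z + Z K^T) + c K Z K^T on 2 x 2 matrices,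
    read row by row. *)
Definition corner_block (a b c n : int) (x : int * int * int * int) :
    int * int * int * int :=
  let: (x00, x01, x10, x11) := x in
  ((a + 2 * b * n + c * (n * n)) * x00,
   (a + b * n) * x01 + (b + c * n) * x00,
   (a + b * n) * x10 + (b + c * n) * x00,
   a * x11 + b * (x01 + x10) + c * x00).

(** x00 has coefficient 1 in y10 and x01 has coefficient 1 in y11. Eliminating both leaves the two
    functionals below, with values d (x11 - x10) and - e x10 on the image. *)
Lemma presents_corner_rook_smith (n : int) (d e : nat) :
  (1 < d)%N -> (1 < e)%N -> d%:Z = 2 * (n - 2) -> e%:Z = 2 * (n - 1) * (n - 2) ->
  presents ('Z_d * 'Z_e)%type (corner_block (-2) 1 0 n).
Proof.
move=> d1 e1 dE eE.
exists (fun y => let: (y00, y01, y10, y11) := y in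
  ((y01 - y10 - (n - 2) * y11)%:~R, (y00 - (2 * n - 2) * y10)%:~R)); split.
- move=> [[[x00 x01] x10] x11] [[[y00 y01] y10] y11].
  by congr (_, _); rewrite -intrB; congr intr; ring.
- move=> [a b]; have [x <-] := Zp_intr_surj a; have [y <-] := Zp_intr_surj b.
  by exists (y, x, 0, 0); congr (_, _); congr intr; ring.
- move=> [[[y00 y01] y10] y11]; split.
    move=> [/(Zp_intr_eq0 _ d1)[q yq] /(Zp_intr_eq0 _ e1)[r yr]].
    exists (y10 + (n - 2) * r, y11 + 2 * q - r, - r, q - r).
    have -> : y01 = d%:Z * q + y10 + (n - 2) * y11 by rewrite -yq; ring.
    have -> : y00 = e%:Z * r + (2 * n - 2) * y10 by rewrite -yr; ring.
    by rewrite dE eE; congr (_, _, _, _); ring.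
  move=> [[[[x00 x01] x10] x11] [-> -> -> ->]]; congr (_, _).
    by apply/(Zp_intr_eq0 _ d1); exists (x11 - x10); rewrite dE; ring.
  by apply/(Zp_intr_eq0 _ e1); exists (- x10); rewrite eE; ring.
Qed.

(** Here a + 2 b n = 0, so y00 vanishes on the image and gives the factor Z. The other functional
    eliminates x00 and x01 and takes the value d (n x11 - x10). *)
Lemma presents_corner_rook_critical (n : int) (d : nat) :
  (1 < d)%N -> d%:Z = 2 * n ->
  presents (int * 'Z_d)%type (corner_block (2 * n) (-1) 0 n).
Proof.
move=> d1 dE.
exists (fun y => let: (y00, y01, y10, y11) := y in
  (y00, (y01 - y10 + n * y11)%:~R)); split.
- move=> [[[x00 x01] x10] x11] [[[y00 y01] y10] y11].
  by congr (_, _); rewrite -intrB; congr intr; ring.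
- move=> [a b]; have [x <-] := Zp_intr_surj b.
  by exists (a, x, 0, 0); congr (_, _); congr intr; ring.
- move=> [[[y00 y01] y10] y11]; split.
    move=> [-> /(Zp_intr_eq0 _ d1)[q yq]].
    (* The kernel is spanned by (n^2, n, n, 1), so x11 = 0 may be imposed. *)
    exists (- n * q - y10, q - y11, - q, 0).
    have -> : y01 = d%:Z * q + y10 - n * y11 by rewrite -yq; ring.
    by rewrite dE; congr (_, _, _, _); ring.
  move=> [[[[x00 x01] x10] x11] [-> -> -> ->]]; congr (_, _); first by ring.
  by apply/(Zp_intr_eq0 _ d1); exists (n * x11 - x10); rewrite dE; ring.
Qed.

(** x11 occurs only in y11, with coefficient 1, so y11 is unconstrained; the other entries are (n -
    1)^2 x00, (n - 1) (x00 - x01) and (n - 1) (x00 - x10). *)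
Lemma presents_corner_compl_smith (n : int) (d e : nat) :
  (1 < d)%N -> (1 < e)%N -> d%:Z = n - 1 -> e%:Z = (n - 1) * (n - 1) ->
  presents ('Z_d * 'Z_d * 'Z_e)%type (corner_block 1 (-1) 1 n).
Proof.
move=> d1 e1 dE eE.
exists (fun y => let: (y00, y01, y10, y11) := y in (y01%:~R, y10%:~R, y00%:~R)); split.
- move=> [[[x00 x01] x10] x11] [[[y00 y01] y10] y11].
  by congr (_, _, _); rewrite -intrB.
- move=> [[a b] c]; have [x <-] := Zp_intr_surj a; have [y <-] := Zp_intr_surj b.
  by have [z <-] := Zp_intr_surj c; exists (z, x, y, 0).
- move=> [[[y00 y01] y10] y11]; split.
    move=> [/(Zp_intr_eq0 _ d1)[q ->] /(Zp_intr_eq0 _ d1)[r ->] /(Zp_intr_eq0 _ e1)[s ->]].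
    exists (s, s - q, s - r, y11 + s - q - r).
    by rewrite dE eE; congr (_, _, _, _); ring.
  move=> [[[[x00 x01] x10] x11] [-> -> -> _]]; congr (_, _, _).
  - by apply/(Zp_intr_eq0 _ d1); exists (x00 - x01); rewrite dE; ring.
  - by apply/(Zp_intr_eq0 _ d1); exists (x00 - x10); rewrite dE; ring.
  - by apply/(Zp_intr_eq0 _ e1); exists x00; rewrite eE; ring.
Qed.

(** Again y00 = 0 on the image. In the last functional the y11 term removes x01 and the y10 term
    removes x00, leaving e (x10 - n x11); as before, x11 = 0 may be imposed on a preimage. *)
Lemma presents_corner_compl_critical (n : int) (d e : nat) :
  (1 < d)%N -> (1 < e)%N -> d%:Z = n - 1 -> e%:Z = n * (n - 1) * (n - 2) ->
  presents (int * ('Z_d * 'Z_e))%type (corner_block (n * (n - 2)) 1 (-1) n).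
Proof.
move=> d1 e1 dE eE.
exists (fun y => let: (y00, y01, y10, y11) := y in
  (y00, (y10%:~R, (y01 + (n - 1) * y10 - n * (n - 1) * y11)%:~R))); split.
- move=> [[[x00 x01] x10] x11] [[[y00 y01] y10] y11].
  by congr (_, (_, _)); rewrite -intrB //; congr intr; ring.
- move=> [a [b c]]; have [x <-] := Zp_intr_surj b; have [y <-] := Zp_intr_surj c.
  by exists (a, y - (n - 1) * x, x, 0); congr (_, (_, _)); congr intr; ring.
- move=> [[[y00 y01] y10] y11]; split.
    move=> [-> /(Zp_intr_eq0 _ d1)[q yq] /(Zp_intr_eq0 _ e1)[r yr]].
    exists (n * r - q, (n - 1) * r + y11 - q, r, 0).
    have -> : y01 = e%:Z * r - (n - 1) * y10 + n * (n - 1) * y11 by rewrite -yr; ring.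
    by rewrite yq dE eE; congr (_, _, _, _); ring.
  move=> [[[[x00 x01] x10] x11] [-> -> -> ->]]; congr (_, (_, _)); first by ring.
    by apply/(Zp_intr_eq0 _ d1); exists (n * x10 - x00); rewrite dE; ring.
  by apply/(Zp_intr_eq0 _ e1); exists (x10 - n * x11); rewrite eE; ring.
Qed.

(** * Splitting the operator *)

Section BlockDecomposition.
Variable m : nat.
Local Notation n := (2 + m)%N.
Local Notation nz := ((2 + m)%N%:Z).
Local Notation J := (const_mx 1 : 'M[int]_n).

Definition grid_op (a b c : int) (X : 'M[int]_n) : 'M[int]_n :=
  a *: X + b *: (J *m X + X *m J) + c *: (J *m X *m J).

Let u : 'cV[int]_m := const_mx 1.
Let e0 : 'cV[int]_2 := delta_mx 0 0.
Let e1 : 'cV[int]_2 := delta_mx 1 0.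

(* The coordinates with respect to e_0, sum_(i > 0) (e_i - e_0) and
   e_i - e_0 (i > 1), a basis in which J has a single nonzero column. *)
Let Q : 'M[int]_n :=
  block_mx (1%:M + e0 *m e1^T) (e0 *m u^T) (- (u *m e1^T)) 1%:M.
Let P : 'M[int]_n :=
  block_mx (1%:M - (m.+1)%:Z *: (e0 *m e1^T)) (- (e0 *m u^T)) (u *m e1^T) 1%:M.

(** J is the all-ones column times the all-ones row. In the new coordinates these become [k] and
    [r], so J becomes the rank one matrix [k *m r]. *)
Let k : 'cV[int]_n := col_mx (nz *: e0 + e1) 0.
Let r : 'rV[int]_n := row_mx e0^T 0.

Let uu : u^T *m u = m%:Z%:M.
Proof.
apply/matrixP=> i j; rewrite !mxE !ord1 (eq_bigr (fun=> 1)) => [|l _].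
  by rewrite sumr_const card_ord natz eqxx.
by rewrite !mxE mulr1.
Qed.

Let e1e0 : e1^T *m e0 = 0.
Proof. by apply/matrixP=> i j; rewrite !mxE !ord1 !big_ord_recl big_ord0 !mxE. Qed.

Let e1e1 : e1^T *m e1 = 1%:M.
Proof. by apply/matrixP=> i j; rewrite !mxE !ord1 !big_ord_recl big_ord0 !mxE. Qed.

Let e0e0 : e0^T *m e0 = 1%:M.
Proof. by apply/matrixP=> i j; rewrite !mxE !ord1 !big_ord_recl big_ord0 !mxE. Qed.

Let QP : Q *m P = 1%:M.
Proof.
rewrite /Q /P mulmx_block.
have E2 : e0 *m e1^T *m (e0 *m e1^T) = 0.
  by rewrite mulmxA -(mulmxA e0) e1e0 mulmx0 mul0mx.
have Eu : e0 *m e1^T *m (e0 *m u^T) = 0.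
  by rewrite mulmxA -(mulmxA e0) e1e0 mulmx0 mul0mx.
have uE : u *m e1^T *m (e0 *m e1^T) = 0.
  by rewrite mulmxA -(mulmxA u) e1e0 mulmx0 mul0mx.
have uE' : u *m e1^T *m (e0 *m u^T) = 0.
  by rewrite mulmxA -(mulmxA u) e1e0 mulmx0 mul0mx.
have Euu : e0 *m u^T *m (u *m e1^T) = m%:Z *: (e0 *m e1^T).
  by rewrite mulmxA -(mulmxA e0) uu mul_mx_scalar -scalemxAl.
rewrite !(mulmxDl, mulmxBr, mulmxDr, mul1mx, mulmx1, mulNmx, mulmxN) Euu.
rewrite -!scalemxAr E2 Eu uE uE' !scaler0 ?subr0 ?addr0 ?oppr0 ?addr0 ?opprK ?add0r.
rewrite scalar_mx_block; congr block_mx; rewrite ?addNr ?subrr //.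
move: (e0 *m e1^T) => E.
by apply/matrixP=> i j; rewrite !mxE; ring.
Qed.

Let PQ : P *m Q = 1%:M. Proof. exact: mulmx1C QP. Qed.

Let onesE : const_mx 1 = col_mx (e0 + e1) u :> 'cV[int]_n.
Proof.
rewrite -col_mx_const; congr col_mx; apply/colP=> i; rewrite !mxE.
by case: i => [[|[|]]].
Qed.

Let Q_ones : Q *m const_mx 1 = k.
Proof.
rewrite onesE /Q /k mul_block_col; congr col_mx.
  rewrite mulmxDl mul1mx mulmxDr -!mulmxA e1e0 e1e1 uu mulmx0 add0r mulmx1.
  rewrite mul_mx_scalar; move: e0 e1 => f0 f1.
  by apply/matrixP=> i j; rewrite !mxE PoszD; ring.
by rewrite mul1mx mulNmx mulmxDr -!mulmxA e1e0 e1e1 mulmx0 add0r mulmx1 addNr.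
Qed.

Let r_Q : r *m Q = const_mx 1.
Proof.
rewrite -[RHS]trmx_const onesE /Q /r mul_row_block tr_col_mx !mul0mx !addr0.
by rewrite mulmxDr mulmx1 !mulmxA e0e0 !mul1mx linearD.
Qed.

Let QJ : Q *m J = k *m r *m Q.
Proof.
rewrite -mulmxA r_Q -Q_ones -mulmxA; congr mulmx.
by apply/matrixP=> i j; rewrite !mxE big_ord1 !mxE mulr1.
Qed.

Let JQ : J *m Q^T = Q^T *m (k *m r)^T.
Proof. by rewrite -[J]trmx_const -!trmx_mul QJ. Qed.

Let kop (a b c : int) (Z : 'M[int]_n) : 'M[int]_n :=
  a *: Z + b *: (k *m r *m Z + Z *m (k *m r)^T) + c *: (k *m r *m Z *m (k *m r)^T).

Let grid_op_conj a b c X : Q *m grid_op a b c X *m Q^T = kop a b c (Q *m X *m Q^T).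
Proof.
rewrite /grid_op /kop !(mulmxDr, mulmxDl) -!scalemxAr -!scalemxAl.
rewrite !(mulmxDr, mulmxDl).
have L Y : Q *m (J *m Y) = k *m r *m (Q *m Y) by rewrite !mulmxA QJ.
have R Y : Y *m J *m Q^T = Y *m Q^T *m (k *m r)^T by rewrite -mulmxA JQ mulmxA.
by congr (_ *: _ + _ *: (_ + _) + _ *: _); rewrite -?mulmxA ?L ?mulmxA ?R.
Qed.

(** [r] reads off coordinate 0, so only row 0 and column 0 of [Z] enter the b and c terms. As [k]
    vanishes beyond its first two entries, these terms respect the block structure. *)
Let kopE a b c Z i j : kop a b c Z i j =
  a * Z i j + b * (k i 0 * Z (lshift m 0) j + Z i (lshift m 0) * k j 0)
  + c * (k i 0 * Z (lshift m 0) (lshift m 0) * k j 0).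
Proof.
have rZ p (Y : 'M_(n, p)) x : (r *m Y) 0 x = Y (lshift m 0) x.
  rewrite /r -[Y in LHS]vsubmxK mul_row_col mul0mx addr0.
  by rewrite /e0 trmx_delta -rowE !mxE.
have Zr p (Y : 'M_(p, n)) x : (Y *m r^T) x 0 = Y x (lshift m 0).
  by rewrite -[Y in LHS]trmxK -trmx_mul [LHS]mxE rZ mxE.
have LE Y x y : (k *m r *m Y) x y = k x 0 * Y (lshift m 0) y.
  by rewrite -mulmxA mxE big_ord1 rZ.
have RE Y x y : (Y *m (k *m r)^T) x y = Y x (lshift m 0) * k y 0.
  by rewrite trmx_mul mulmxA mxE big_ord1 Zr mxE.
have addE (A B : 'M[int]_n) x y : (A + B) x y = A x y + B x y by rewrite mxE.
have scaleE s (A : 'M[int]_n) x y : (s *: A) x y = s * A x y by rewrite mxE.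
by rewrite /kop !(addE, scaleE, RE, LE).
Qed.

Let k0 : k (lshift m 0) 0 = nz.
Proof. by rewrite /k col_mxEu !mxE /= mulr1 addr0. Qed.

Let k1 : k (lshift m 1) 0 = 1.
Proof. by rewrite /k col_mxEu !mxE /= mulr0 add0r. Qed.

Let kr i : k (rshift 2 i) 0 = 0.
Proof. by rewrite /k col_mxEd mxE. Qed.

Local Notation pieces :=
  (int * int * int * int
   * (('rV[int]_m * 'rV[int]_m) * ('rV[int]_m * 'rV[int]_m)) * 'M[int]_m)%type.

(** The lower left block is transposed so that both off-diagonal blocks undergo the same
    [row_block]. *)
Let split_mx (Z : 'M[int]_n) : pieces :=
  ((ulsubmx Z 0 0, ulsubmx Z 0 1, ulsubmx Z 1 0, ulsubmx Z 1 1),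
   ((row 0 (ursubmx Z), row 1 (ursubmx Z)),
    (row 0 (dlsubmx Z)^T, row 1 (dlsubmx Z)^T)),
   drsubmx Z).

Let two_rows (p : nat) (x : 'rV[int]_p * 'rV[int]_p) : 'M[int]_(2, p) :=
  \matrix_(i, j) (if i == 0 then x.1 else x.2) 0 j.

Let two_rowsK p (X : 'M[int]_(2, p)) : two_rows (row 0 X, row 1 X) = X.
Proof. by apply/matrixP=> -[[|[|//]] ?] j; rewrite !mxE; congr (X _ _); apply: val_inj. Qed.

Let row0_two_rows p x : row 0 (@two_rows p x) = x.1.
Proof. by apply/rowP=> j; rewrite !mxE. Qed.

Let row1_two_rows p x : row 1 (@two_rows p x) = x.2.
Proof. by apply/rowP=> j; rewrite !mxE. Qed.

Let join_mx (z : pieces) : 'M[int]_n :=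
  let: (z00, z01, z10, z11, (rr, cc), D) := z in
  block_mx (\matrix_(i, j) (if i == 0 then if j == 0 then z00 else z01
                            else if j == 0 then z10 else z11))
    (two_rows rr) (two_rows cc)^T D.

Let split_mxK : cancel split_mx join_mx.
Proof.
move=> Z; rewrite /split_mx /join_mx !two_rowsK trmxK -[RHS]submxK; congr block_mx.
by apply/matrixP=> -[[|[|//]] ?] [[|[|//]] ?]; rewrite !mxE /=;
  congr (Z _ _); apply: val_inj.
Qed.

Let join_mxK : cancel join_mx split_mx.
Proof.
move=> [[[[[z00 z01] z10] z11] [rr cc]] D]; rewrite /split_mx /join_mx.
rewrite block_mxKul block_mxKur block_mxKdl block_mxKdr trmxK !row0_two_rows.
by rewrite !row1_two_rows -!surjective_pairing !mxE.
Qed.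

Let split_mxB : {morph split_mx : X Y / X - Y}.
Proof.
move=> X Y; rewrite /split_mx.
by congr (_, _, _, _, (_, _, (_, _)), _); try apply/matrixP=> ? ?; rewrite !mxE.
Qed.

Let split_kop a b c Z : split_mx (kop a b c Z) =
  (corner_block a b c nz (split_mx Z).1.1,
   (row_block a b nz (split_mx Z).1.2.1, row_block a b nz (split_mx Z).1.2.2),
   a *: (split_mx Z).2).
Proof.
move: (kop a b c Z) (kopE a b c Z) => W WE; rewrite /split_mx /row_block.
have E (p q : nat) (f g : 'M[int]_(p, q)) : (forall x y, f x y = g x y) -> f = g.
  by move=> fg; apply/matrixP.
congr (_, _, _, _, (_, _, (_, _)), _); try (apply: E => x y);
  rewrite ![in LHS]mxE WE ?k0 ?k1 ?kr ![in RHS]mxE; ring.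
Qed.

Lemma presents_grid_op (a b c : int) (B4 B2 B1 : zmodType) :
  presents B4 (corner_block a b c nz) ->
  presents B2 (@row_block m a b nz) ->
  presents B1 (fun X : 'M[int]_m => a *: X) ->
  presents (B4 * (B2 * B2) * B1)%type (grid_op a b c).
Proof.
move=> p4 p2 p1.
have pk : presents (B4 * (B2 * B2) * B1)%type (kop a b c).
  apply: presents_conj split_mxB split_mxK join_mxK join_mxK _
    (presents_prod (presents_prod p4 (presents_prod p2 p2)) p1).
  exact: split_kop.
apply: (presents_conj (g := fun X => Q *m X *m Q^T) (g' := fun X => P *m X *m P^T)
  (h := fun X => Q *m X *m Q^T) (h' := fun X => P *m X *m P^T)) pk.
- by move=> X Y; rewrite mulmxBr mulmxBl.
- by move=> X; rewrite !mulmxA PQ mul1mx -mulmxA -trmx_mul PQ trmx1 mulmx1.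
- by move=> X; rewrite !mulmxA QP mul1mx -mulmxA -trmx_mul QP trmx1 mulmx1.
- by move=> X; rewrite !mulmxA QP mul1mx -mulmxA -trmx_mul QP trmx1 mulmx1.
- by move=> X; rewrite grid_op_conj.
Qed.

End BlockDecomposition.

(** * The rook's graph and its complement *)

Section GridMatrix.
Variable m : nat.
Local Notation n := (2 + m)%N.
Local Notation cell := ('I_n * 'I_n)%type.

(** The entries of a I (x) I + b (I (x) J + J (x) I) + c J (x) J, with (x) the Kronecker product. *)
Definition grid_weight (a b c : int) (u v : cell) : int :=
  a * ((u.1 == v.1)%:R * (u.2 == v.2)%:R)
  + b * ((u.1 == v.1)%:R + (u.2 == v.2)%:R) + c.

Lemma grid_weight_sum (a b c : int) (X : 'M[int]_n) (u : cell) :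
  \sum_v grid_weight a b c u v * X v.1 v.2 = grid_op a b c X u.1 u.2.
Proof.
case: u => i j.
have delta (F : 'I_n -> int) x : \sum_y (x == y)%:R * F y = F x.
  rewrite (bigD1 x) //= eqxx mul1r big1 ?addr0 // => y yx.
  by rewrite eq_sym (negPf yx) mul0r.
have JX (Y : 'M[int]_n) x y : (const_mx 1 *m Y : 'M_n) x y = \sum_z Y z y.
  by rewrite mxE; apply: eq_bigr => z _; rewrite mxE mul1r.
have XJ (Y : 'M[int]_n) x y : (Y *m const_mx 1 : 'M_n) x y = \sum_z Y x z.
  by rewrite mxE; apply: eq_bigr => z _; rewrite mxE mulr1.
have addE (A B : 'M[int]_n) x y : (A + B) x y = A x y + B x y by rewrite mxE.
have scaleE s (A : 'M[int]_n) x y : (s *: A) x y = s * A x y by rewrite mxE.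
rewrite /grid_op !(addE, scaleE, JX, XJ).
under [X in c * X]eq_bigr => z _ do rewrite JX.
pose D1 (v : cell) : int := (i == v.1)%:R; pose D2 (v : cell) : int := (j == v.2)%:R.
(* [D2] fixes the column, so its sum is an entry of J X; [D1] fixes the row and gives X J. *)
transitivity (a * (\sum_v D1 v * (D2 v * X v.1 v.2))
  + b * (\sum_v D2 v * X v.1 v.2 + \sum_v D1 v * X v.1 v.2) + c * \sum_(v : cell) X v.1 v.2).
  rewrite mulrDr !mulr_sumr -!big_split /=; apply: eq_bigr => v _.
  by rewrite /grid_weight /D1 /D2 /=; ring.
rewrite /D1 /D2; congr (_ * _ + _ * (_ + _) + _ * _).
- rewrite -(pair_bigA _ (fun x y => (i == x)%:R * ((j == y)%:R * X x y))) /=.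
  by under eq_bigr => x _ do rewrite -mulr_sumr delta; rewrite delta.
- rewrite -(pair_bigA _ (fun x y => (j == y)%:R * X x y)) /=.
  by under eq_bigr => x _ do rewrite delta.
- rewrite -(pair_bigA _ (fun x y => (i == x)%:R * X x y)) /=.
  by under eq_bigr => x _ do rewrite -mulr_sumr; rewrite delta.
- by rewrite -(pair_bigA _ (fun x y => X x y)) /= exchange_big.
Qed.

Lemma presents_grid_mx (a b c : int) (B : zmodType) (M : 'M[int]_#|{: cell}|) :
  (forall i j, M i j = grid_weight a b c (enum_val i) (enum_val j)) ->
  presents B (@grid_op m a b c) -> presents B (fun x : 'cV_#|{: cell}| => M *m x).
Proof.
move=> ME.
pose h (x : 'cV[int]_#|{: cell}|) : 'M[int]_n := \matrix_(i, j) x (enum_rank (i, j)) 0.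
pose h' (X : 'M[int]_n) : 'cV[int]_#|{: cell}| :=
  \col_i X (enum_val i).1 (enum_val i).2.
have hK : cancel h h'.
  by move=> x; apply/colP=> i; rewrite !mxE -surjective_pairing enum_valK.
have h'K : cancel h' h by move=> X; apply/matrixP=> i j; rewrite !mxE enum_rankK.
apply: (presents_conj (h := h) (h' := h') (g := h) (g' := h')) => //.
  by move=> x y; apply/matrixP=> i j; rewrite !mxE.
move=> x; apply/matrixP=> i j; rewrite -(grid_weight_sum _ _ _ _ (i, j)) !mxE.
rewrite (reindex enum_rank) /=; last by apply: onW_bij; apply: enum_rank_bij.
by apply: eq_bigr => v _; rewrite ME !enum_rankK mxE -surjective_pairing.
Qed.

Lemma grid_degree (a b c : int) (adj : rel cell) (u : cell) :
  (forall v, (adj u v)%:R = grid_weight a b c u v) ->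
  #|[set v | adj u v]|%:Z = a + 2 * b * n%:Z + c * (n%:Z * n%:Z).
Proof.
move=> adjE; rewrite -sum1dep_card -natz natr_sum big_mkcond /=.
(* The degree is a row sum, that is, an entry of the image of J under [grid_op]. *)
transitivity (\sum_v grid_weight a b c u v * (const_mx 1 : 'M[int]_n) v.1 v.2).
  by apply: eq_bigr => v _; rewrite mxE mulr1 -adjE; case: (adj u v).
rewrite grid_weight_sum /grid_op.
pose J : 'M[int]_n := const_mx 1.
have JJ : J *m J = const_mx n%:Z.
  apply/matrixP=> x y; rewrite !mxE (eq_bigr (fun=> 1)) => [|z _].
    by rewrite sumr_const card_ord natz.
  by rewrite !mxE mulr1.
have JJJ : J *m J *m J = const_mx (n%:Z * n%:Z).
  rewrite JJ; apply/matrixP=> x y; rewrite !mxE (eq_bigr (fun=> n%:Z)) => [|z _].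
    by rewrite sumr_const card_ord -mulr_natr natz.
  by rewrite !mxE mulr1.
by rewrite -/J JJJ JJ !mxE; ring.
Qed.

(** The b term counts shared lines: 1 for adjacent squares, 2 for equal ones, which a = -2
    cancels. *)
Lemma rook_weight (u v : cell) : (rook_adj u v)%:R = grid_weight (-2) 1 0 u v.
Proof.
case: u v => [i j] [k l]; rewrite /rook_adj /grid_weight /= xpair_eqE.
by case: (i == k); case: (j == l).
Qed.

(** All-ones minus identity minus the rook weight: a = -1 + 2, b = -1, c = 1. *)
Lemma compl_rook_weight (u v : cell) :
  (@compl_adj (rook n) u v)%:R = grid_weight 1 (-1) 1 u v.
Proof.
case: u v => [i j] [k l]; rewrite /compl_adj /= /rook_adj /grid_weight /= xpair_eqE.
by case: (i == k); case: (j == l).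
Qed.

Lemma presents_rook_adjacency (B : zmodType) : presents B (@grid_op m (-2) 1 0) ->
  presents B (fun x : 'cV_#|rook n| => adjacency (rook n) *m x).
Proof. by apply: presents_grid_mx => i j; rewrite mxE rook_weight. Qed.

Lemma presents_compl_adjacency (B : zmodType) : presents B (@grid_op m 1 (-1) 1) ->
  presents B (fun x : 'cV_#|complement (rook n)| => adjacency (complement (rook n)) *m x).
Proof. by apply: presents_grid_mx => i j; rewrite mxE compl_rook_weight. Qed.

Lemma grid_weight_opp (a b c d : int) (u v : cell) :
  d *+ (u == v) - grid_weight a b c u v = grid_weight (d - a) (- b) (- c) u v.
Proof.
case: u v => [i j] [k l]; rewrite /grid_weight /= xpair_eqE.
by case: (i == k); case: (j == l); rewrite /= ?mulr1n ?mulr0n; ring.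
Qed.

Lemma presents_rook_laplacian (B : zmodType) :
  presents B (@grid_op m (2 * n%:Z) (-1) 0) ->
  presents B (fun x : 'cV_#|rook n| => laplacian (rook n) *m x).
Proof.
apply: presents_grid_mx => i j; rewrite !mxE rook_weight.
rewrite -(inj_eq enum_val_inj) /degree natz.
(* The degree is 2 n - 2, so the scalar coefficient becomes (2 n - 2) + 2 = 2 n. *)
rewrite (@grid_degree (-2) 1 0 (@adj (rook n))) ?grid_weight_opp; last first.
  by move=> v; rewrite rook_weight.
by congr grid_weight; ring.
Qed.

Lemma presents_compl_laplacian (B : zmodType) :
  presents B (@grid_op m (n%:Z * (n%:Z - 2)) 1 (-1)) ->
  presents B (fun x : 'cV_#|complement (rook n)| => laplacian (complement (rook n)) *m x).
Proof.
apply: presents_grid_mx => i j; rewrite !mxE compl_rook_weight.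
rewrite -(inj_eq enum_val_inj) /degree natz.
(* The degree is (n - 1)^2, and (n - 1)^2 - 1 = n (n - 2). *)
rewrite (@grid_degree 1 (-1) 1 (@adj (complement (rook n)))) ?grid_weight_opp; last first.
  by move=> v; rewrite compl_rook_weight.
by congr grid_weight; ring.
Qed.

End GridMatrix.

(** * Regrouping of the summands and the four isomorphisms *)

Lemma rV_Zp_mulrn (d k N : nat) (x : 'rV['Z_d]_k) : (1 < d)%N -> (d %| N)%N -> x *+ N = 0.
Proof.
move=> d1 /dvdnP[q ->]; apply/rowP=> i; rewrite mulmxnE mxE.
by rewrite -mulr_natr natrM pchar_Zp // !mulr0.
Qed.

Lemma pair_mulrn_eq0 (A B : zmodType) (N : nat) (x : A * B) :
  x.1 *+ N = 0 -> x.2 *+ N = 0 -> x *+ N = 0.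
Proof.
move=> x1 x2; rewrite [LHS]surjective_pairing.
by rewrite (raddfMn fst) (raddfMn snd) x1 x2.
Qed.

Lemma zmod_iso_torsion_cokernel (k : nat) (M : 'M[int]_k) (B : zmodType) (N : nat) :
  presents (int * B)%type (fun x : 'cV[int]_k => M *m x) ->
  (0 < N)%N -> (forall b : B, b *+ N = 0) -> zmod_iso (torsion (cokernel M)) B.
Proof.
move=> /presents_cokernel/zmod_iso_torsion h N0 BN.
exact: zmod_iso_trans h (torsion_int_prod N0 BN).
Qed.

Lemma zmod_iso_Zp_eq (d e : nat) : d = e -> zmod_iso 'Z_d 'Z_e.
Proof. by move=> ->; apply: zmod_iso_refl. Qed.

Lemma zmod_iso_rVD (R : zmodType) (A B : zmodType) (k l p : nat) :
  zmod_iso A 'rV[R]_k -> zmod_iso B 'rV[R]_l -> (k + l)%N = p ->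
  zmod_iso (A * B)%type 'rV[R]_p.
Proof.
move=> hA hB <-; apply: zmod_iso_trans (zmod_iso_prod hA hB) _.
exact: zmod_iso_rowD.
Qed.

Lemma zmod_iso_mx (R : zmodType) (k l p : nat) :
  (k * l)%N = p -> zmod_iso 'M[R]_(k, l) 'rV[R]_p.
Proof. by move=> <-; apply: zmod_iso_mxvec. Qed.

Lemma zmod_iso_to_rV1 (R : zmodType) : zmod_iso R 'rV[R]_1.
Proof. exact/zmod_iso_sym/zmod_iso_rV1. Qed.

(** This and the next three lemmas reorder the summands given by [presents_grid_op]. For critical
    groups the free factor Z stays in front, to be removed by passing to torsion. *)
Lemma zmod_iso_shuffle_rook_critical (Z A R S M : zmodType) :
  zmod_iso (Z * A * (R * S) * M)%type (Z * (M * A * (R * S)))%type.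
Proof.
apply: (@zmod_isoI _ _ (fun x : Z * A * (R * S) * M =>
  let: (z, a, rs, y) := x in (z, (y, a, rs)))).
  by move=> [[[? ?] ?] ?] [[[? ?] ?] ?].
exists (fun x => let: (z, (y, a, rs)) := x in (z, a, rs, y)).
  by move=> [[[? ?] ?] ?].
by move=> [? [[? ?] ?]].
Qed.

Lemma zmod_iso_shuffle_rook_smith (A E R S M : zmodType) :
  zmod_iso (A * E * (R * S) * M)%type (M * (A * (R * S)) * E)%type.
Proof.
apply: (@zmod_isoI _ _ (fun x : A * E * (R * S) * M =>
  let: (a, e, rs, y) := x in (y, (a, rs), e))).
  by move=> [[[? ?] ?] ?] [[[? ?] ?] ?].
exists (fun x => let: (y, (a, rs), e) := x in (a, e, rs, y)).
  by move=> [[[? ?] ?] ?].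
by move=> [[? [? ?]] ?].
Qed.

Lemma zmod_iso_shuffle_compl_critical (Z D E R S M A : zmodType) :
  zmod_iso (Z * (D * E) * (R * S) * (M * A))%type
           (Z * (M * (A * D * E) * (R * S)))%type.
Proof.
apply: (@zmod_isoI _ _ (fun x : Z * (D * E) * (R * S) * (M * A) =>
  let: (z, (d, e), rs, (y, a)) := x in (z, (y, (a, d, e), rs)))).
  by move=> [[[? [? ?]] ?] [? ?]] [[[? [? ?]] ?] [? ?]].
exists (fun x => let: (z, (y, (a, d, e), rs)) := x in (z, (d, e), rs, (y, a))).
  by move=> [[[? [? ?]] ?] [? ?]].
by move=> [? [[? [[? ?] ?]] ?]].
Qed.

Lemma zmod_iso_shuffle_compl_smith (A E R : zmodType) :
  zmod_iso (A * E * R)%type (A * R * E)%type.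
Proof.
apply: (@zmod_isoI _ _ (fun x : A * E * R => (x.1.1, x.2, x.1.2))).
  by move=> [[? ?] ?] [[? ?] ?].
by exists (fun x => (x.1.1, x.2, x.1.2)) => -[[? ?] ?].
Qed.

Theorem theorem1 (n : nat) (hn : (3 <= n)%N) :
  [/\ zmod_iso (critical_group (rook n))
        ('rV['Z_(2 * n)]_((n - 2) ^ 2 + 1)
         * 'rV['Z_(2 * n ^ 2)]_(2 * (n - 2)))%type,
      zmod_iso (smith_group (rook n))
        ('rV['Z_2]_((n - 2) ^ 2)
         * 'rV['Z_(2 * (n - 2))]_(2 * n - 3)
         * 'Z_(2 * (n - 1) * (n - 2)))%type,
      zmod_iso (critical_group (complement (rook n)))
        ('rV['Z_(n * (n - 2))]_((n - 2) ^ 2 - 1)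
         * 'rV['Z_(n * (n - 1) * (n - 2))]_2
         * 'rV['Z_(n ^ 2 * (n - 1) * (n - 2))]_(2 * (n - 2)))%type
    & zmod_iso (smith_group (complement (rook n)))
        ('rV['Z_(n - 1)]_(2 * (n - 1)) * 'Z_((n - 1) ^ 2))%type].
Proof.
(* m > 0 keeps every modulus in the statement above 1. *)
have [m [nE m0]] : exists m, (n = 2 + m)%N /\ (0 < m)%N by exists (n - 2)%N; lia.
subst n; rewrite -!mulnn; split.
- apply: (@zmod_iso_torsion_cokernel _ _ _ (2 * ((2 + m) * (2 + m)))%N); last first.
  + move=> b; apply: pair_mulrn_eq0; apply: rV_Zp_mulrn; try nia; last exact: dvdnn.
    by rewrite mulnA dvdn_mulr.
  + nia.
  apply/presents_rook_laplacian.
  apply: presents_iso.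
    apply: presents_grid_op.
    + by apply: (@presents_corner_rook_critical _ (2 * (2 + m))); lia.
    + by apply: (@presents_row_block _ (2 * ((2 + m) * (2 + m)))); nia.
    + by apply: (@presents_scale _ _ (2 * (2 + m))); lia.
  apply: zmod_iso_trans (zmod_iso_shuffle_rook_critical _ _ _ _ _) _.
  apply: zmod_iso_prod; first exact: zmod_iso_refl.
  apply: zmod_iso_prod.
    (* The (n - 2)^2 scalar blocks and the corner each give copies of Z/2n. *)
    by apply: zmod_iso_rVD (zmod_iso_mx _ (erefl _)) (zmod_iso_to_rV1 _) _; nia.
  by apply: zmod_iso_rVD (zmod_iso_refl _) (zmod_iso_refl _) _; lia.
- apply/presents_cokernel/presents_rook_adjacency.
  apply: presents_iso.
    apply: presents_grid_op.
    + by apply: (@presents_corner_rook_smith _ (2 * (2 + m - 2))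
        (2 * (2 + m - 1) * (2 + m - 2))); nia.
    + by apply: (@presents_row_block _ (2 * (2 + m - 2))); nia.
    + by apply: (@presents_scale _ _ 2); lia.
  apply: zmod_iso_trans (zmod_iso_shuffle_rook_smith _ _ _ _ _) _.
  apply: zmod_iso_prod; last exact: zmod_iso_refl.
  apply: zmod_iso_prod; first by apply: zmod_iso_mx; nia.
  (* One copy from the corner and n - 2 from each row block: 1 + 2 (n - 2) = 2 n - 3. *)
  apply: zmod_iso_rVD (zmod_iso_to_rV1 _) _ _.
    exact: zmod_iso_rVD (zmod_iso_refl _) (zmod_iso_refl _) (erefl _).
  by lia.
(* f is the row modulus a (a + n), and also a common multiple of a and e, hence an exponent of the
   whole group. *)
- set f := (_ * _ * (2 + m - 1) * _)%N.
  set e := ((2 + m) * (2 + m - 1) * _)%N; set a := ((2 + m) * (2 + m - 2))%N.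
  have f1 : (1 < f)%N by rewrite /f; nia.
  have e1 : (1 < e)%N by rewrite /e; nia.
  have a1 : (1 < a)%N by rewrite /a; nia.
  apply: (@zmod_iso_torsion_cokernel _ _ _ f); last first.
  + move=> b; apply: pair_mulrn_eq0; last exact: rV_Zp_mulrn.
    apply: pair_mulrn_eq0; apply: rV_Zp_mulrn => //.
      by apply/dvdnP; exists ((2 + m) * (2 + m - 1))%N; rewrite /f /a; nia.
    by apply/dvdnP; exists (2 + m)%N; rewrite /f /e; nia.
  + exact: ltnW.
  apply/presents_compl_laplacian.
  apply: presents_iso.
    apply: presents_grid_op.
    + by apply: (@presents_corner_compl_critical _ (2 + m - 1) e); rewrite // /e; nia.
    + by apply: (@presents_row_block _ f); rewrite // /f; nia.
    + by apply: (@presents_scale _ _ a); rewrite // /a; nia.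
  (* One of the (n - 2)^2 copies of Z/a is split off; joined to the corner summand Z/(n - 1), it
     yields the second copy of Z/e. *)
  apply: zmod_iso_trans.
    apply: zmod_iso_prod; first exact: zmod_iso_refl.
    apply: zmod_iso_trans (zmod_iso_mx _ (_ : _ = ((2 + m - 2) * (2 + m - 2) - 1) + 1)%N) _.
      by nia.
    apply: zmod_iso_trans (zmod_iso_sym (zmod_iso_rowD _ _ _)) _.
    by apply: zmod_iso_prod (zmod_iso_refl _) (zmod_iso_rV1 _).
  apply: zmod_iso_trans (zmod_iso_shuffle_compl_critical _ _ _ _ _ _ _) _.
  apply: zmod_iso_prod (zmod_iso_refl _) _; apply: zmod_iso_prod.
    apply: zmod_iso_prod (zmod_iso_refl _) _.
    apply: zmod_iso_rVD _ (zmod_iso_to_rV1 _) (erefl (1 + 1)%N).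
      apply: zmod_iso_trans _ (zmod_iso_to_rV1 _).
      (* (n - 1)^2 - n (n - 2) = 1 *)
      apply: zmod_iso_trans (@zmod_iso_Zp_prod _ _ (-1) (m.+1)%:Z _ _ _) _ => //.
      + by lia.
      + by apply: zmod_iso_Zp_eq; rewrite /a /e; nia.
  by apply: zmod_iso_rVD (zmod_iso_refl _) (zmod_iso_refl _) _; lia.
- apply/presents_cokernel/presents_compl_adjacency.
  apply: presents_iso.
    apply: presents_grid_op.
    + by apply: (@presents_corner_compl_smith _ (2 + m - 1)
        ((2 + m - 1) * (2 + m - 1))); nia.
    + by apply: (@presents_row_block _ (2 + m - 1)); nia.
    + exact: presents_scale_unit.
  apply: zmod_iso_trans (zmod_iso_prod0 _ _) _; first by move=> z; apply/rowP; case.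
  apply: zmod_iso_trans (zmod_iso_shuffle_compl_smith _ _ _) _.
  apply: zmod_iso_prod (zmod_iso_refl _).
  (* Two copies from the corner and n - 2 from each row block: 2 + 2 (n - 2) = 2 (n - 1). *)
  apply: zmod_iso_rVD.
  + exact: zmod_iso_rVD (zmod_iso_to_rV1 _) (zmod_iso_to_rV1 _) (erefl _).
  + exact: zmod_iso_rVD (zmod_iso_refl _) (zmod_iso_refl _) (erefl _).
  + by lia.
Qed.
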